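(* For any $\beta\in(-1,1)$, the process $Z_\beta=(Z_\beta(t))_{t\in\mathbb{R}_+}$ is $\left(1-\frac{\beta}{2},\,-\beta-1\right)$-dilatively stable.
   Context: Here $\mathbb{R}_+=[0,\infty)$ and $\mathbb{N}$ is the set of positive integers. A process $(X_t)_{t\in\mathbb{R}_+}$ is infinitely divisible if all its finite-dimensional distributions are infinitely divisible. For such a process, the characteristic exponent of $(X_{t_1},\ldots,X_{t_k})$ is the unique continuous function $\psi_{t_1,\ldots,t_k}:\mathbb{R}^k\to\mathbb{C}$ with $\psi_{t_1,\ldots,t_k}(0,\ldots,0)=0$ and $\mathbb{E}\left(e^{i\sum_{j=1}^k\theta_jX_{t_j}}\right)=e^{-\psi_{t_1,\ldots,t_k}(\theta_1,\ldots,\theta_k)}$ for all $\theta_1,\ldots,\theta_k\in\mathbb{R}$. For $\alpha,\delta\in\mathbb{R}$, an infinitely divisible process $(X_t)_{t\in\mathbb{R}_+}$ is called $(\alpha,\delta)$-dilatively stable if $$\psi_{Tt_1,\ldots,Tt_k}(\theta_1,\ldots,\theta_k)=T^{\delta}\,\psi_{t_1,\ldots,t_k}\left(T^{\alpha-\frac{\delta}{2}}\theta_1,\ldots,T^{\alpha-\frac{\delta}{2}}\theta_k\right)$$ for all $T>0$, $k\in\mathbb{N}$, $\theta_1,\ldots,\theta_k\in\mathbb{R}$, $t_1,\ldots,t_k\in\mathbb{R}_+$. For $\beta\in(-1,1)$, $Z_\beta$ denotes the infinitely divisible process (known to exist; it arises as a limit in joint temporal and contemporaneous aggregation of random-coefficient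 AR(1) processes) whose finite-dimensional distributions are determined by the following characteristic exponent of $(Z_\beta(t_1),\ldots,Z_\beta(t_k))$: $$\psi_{t_1,\ldots,t_k}(\theta_1,\ldots,\theta_k)=-C\int_0^\infty\left(\exp\left\{-\frac12\int_{\mathbb{R}}\left(\sum_{j=1}^k\theta_j\bigl(f(x,t_j-s)-f(x,-s)\bigr)\right)^2\mathrm{d}s\right\}-1\right)x^{\beta}\,\mathrm{d}x$$ for all $k\in\mathbb{N}$, $t_1,\ldots,t_k\in\mathbb{R}_+$, $\theta_1,\ldots,\theta_k\in\mathbb{R}$, where $C>0$ is a constant (not depending on $k$, the $t_j$ or the $\theta_j$) and $f:\mathbb{R}^2\to\mathbb{R}$ is given by $$f(x,t):=\begin{cases}\dfrac{1-e^{-xt}}{x}&\text{if }x>0\text{ and }t>0,\\[1ex]0&\text{otherwise.}\end{cases}$$ *)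

(* Defs.v *)
From HB Require Import structures.
From mathcomp Require Import all_boot all_order all_algebra.
From mathcomp Require Import complex.
From mathcomp Require Import all_classical all_reals all_analysis.

Set Implicit Arguments.
Unset Strict Implicit.
Unset Printing Implicit Defensive.

Import Order.TTheory GRing.Theory Num.Theory.
Import numFieldNormedType.Exports.

Local Open Scope classical_set_scope.
Local Open Scope ring_scope.
Local Open Scope complex_scope.

Section complex_valued.
Context {R : realType}.

Definition cexp (z : R[i]) : R[i] :=
  (expR (complex.Re z) * cos (complex.Im z))
    +i* (expR (complex.Re z) * sin (complex.Im z)).

Context {d} {T : measurableType d}.

Definition Cintegral (mu : {measure set T -> \bar R}) (f : T -> R[i]) : R[i] :=
  (\int[mu]_w complex.Re (f w)) +i* (\int[mu]_w complex.Im (f w)).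

End complex_valued.

Section infinitely_divisible_laws.
Context {R : realType} {k : nat}.
Implicit Types (nu : probability (k.-tuple R) R) (A : set (k.-tuple R)).

Definition tuple_add (x y : k.-tuple R) : k.-tuple R :=
  [tuple tnth x i + tnth y i | i < k].

Definition tuple_zero : k.-tuple R := [tuple 0 | _ < k].

(* n-th convolution power, via (nu^{*(n+1)})(A) = int nu^{*n}(A - x) nu(dx);
   only its values on measurable sets are meaningful *)
Fixpoint convolution_power nu (n : nat) A : \bar R :=
  match n with
  | 0%N => \d_tuple_zero A
  | n'.+1 =>
      (\int[nu]_x convolution_power nu n' [set y | A (tuple_add x y)])%E
  end.

Definition infinitely_divisible (mu : probability (k.-tuple R) R) : Prop :=
  forall n : nat, (0 < n)%N ->
    exists nu : probability (k.-tuple R) R,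
      forall A, measurable A -> mu A = convolution_power nu n A.

End infinitely_divisible_laws.

Section processes.
Context {R : realType} {d} {Omega : measurableType d} {P : probability Omega R}.
Implicit Types X : {nonneg R} -> {RV P >-> R}.

Definition fdd_vector X (k : nat) (t : 'I_k -> {nonneg R})
  : Omega -> k.-tuple R := fun w => [tuple X (t j) w | j < k].

Lemma measurable_fdd_vector X k (t : 'I_k -> {nonneg R}) :
  measurable_fun [set: Omega] (fdd_vector X t).
Proof.
apply: (iffRL (measurable_fun_tnthP _)) => i.
rewrite (_ : _ \o _ = X (t i)) //.
by apply/funext => w /=; rewrite tnth_mktuple.
Qed.

HB.instance Definition _ X k (t : 'I_k -> {nonneg R}) :=
  isMeasurableFun.Build _ _ Omega (k.-tuple R) (fdd_vector X t)
    (measurable_fdd_vector X t).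

Definition infinitely_divisible_process X : Prop :=
  forall (k : nat) (t : 'I_k -> {nonneg R}), (0 < k)%N ->
    infinitely_divisible (distribution P (fdd_vector X t)).

Definition is_char_exponent X (k : nat) (t : 'I_k -> {nonneg R})
    (psi : 'rV[R]_k -> R[i]^o) : Prop :=
  [/\ continuous psi, psi 0 = 0 &
      forall theta : 'rV[R]_k,
        Cintegral P (fun w => cexp ('i * (\sum_(j < k) theta 0 j * X (t j) w)%:C))
        = cexp (- psi theta)].

(* the definite description "the unique psi such that ..."; the default value
   is never used for an infinitely divisible process *)
Definition char_exponent X (k : nat) (t : 'I_k -> {nonneg R})
  : 'rV[R]_k -> R[i] :=
  xget (fun=> 0) [set psi | is_char_exponent X t psi].

Definition dilatively_stable (alpha delta : R) X : Prop :=
  infinitely_divisible_process X /\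
  forall (T : {posnum R}) (k : nat) (theta : 'rV[R]_k)
    (t : 'I_k -> {nonneg R}), (0 < k)%N ->
    char_exponent X (fun j => (T%:num * (t j)%:num)%:nng) theta
    = (T%:num `^ delta)%:C
      * char_exponent X t (T%:num `^ (alpha - delta / 2) *: theta).

End processes.

Section Zbeta.
Context {R : realType}.

Definition Zbeta_kernel (x t : R) : R :=
  if (0 < x) && (0 < t) then (1 - expR (- (x * t))) / x else 0.

Definition Zbeta_exponent (beta C : R) (k : nat) (t : 'I_k -> {nonneg R})
    (theta : 'rV[R]_k) : R :=
  - C * \int[lebesgue_measure]_(x in `]0, +oo[)
    ((expR (- (1 / 2) * \int[lebesgue_measure]_s
        (\sum_(j < k) theta 0 j *
           (Zbeta_kernel x ((t j)%:num - s) - Zbeta_kernel x (- s))) ^+ 2)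
      - 1) * x `^ beta).

Definition is_Zbeta {d} {Omega : measurableType d} {P : probability Omega R}
    (beta C : R) (Z : {nonneg R} -> {RV P >-> R}) : Prop :=
  infinitely_divisible_process Z /\
  forall (k : nat) (t : 'I_k -> {nonneg R}), (0 < k)%N ->
    is_char_exponent Z t (fun theta => (Zbeta_exponent beta C t theta)%:C).

End Zbeta.

(* Main.v *)
Require Import Defs.
From mathcomp Require Import all_boot all_order all_algebra.
From mathcomp Require Import complex ring.
From mathcomp Require Import all_classical all_reals all_analysis measurable_realfun.

Import Order.TTheory GRing.Theory Num.Theory.
Local Open Scope ring_scope.

(** Both integrals in the exponent of Z_beta are homogeneous, and dilative
    stability is what two linear substitutions make of this.

    The kernel satisfies f(x, T u) = T f(T x, u).  Substituting s = T s' in the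
    inner integral at the times T t_j gives T^3 times the inner integral at the
    times t_j and the point T x ([Zbeta_energy_dilation]); the factor T^3 of
    this quadratic form in theta is absorbed by replacing theta by
    T^(3/2) theta.  Substituting y = T x in the outer integral, the weight
    x^beta dx yields T^(-beta-1) ([Zbeta_exponent_dilation]).  With
    delta = - beta - 1 and alpha = 1 - beta / 2 one has
    alpha - delta / 2 = 3 / 2, which is the claim.

    The substitution rule [Rintegral_dilation] is proved for an arbitrary
    integrand, directly from the definition of the integral as a supremum: a
    dilation of the line carries the simple functions below f to those below the
    dilated f.  So the two substitutions can be made without studying the
    integrand, whose outer factor is itself defined by an integral.

    The definition of stability speaks of the characteristic exponent, a
    continuous logarithm of the characteristic function vanishing at 0.  It is
    unique ([char_exponent_unique]): two of them differ by a multiple of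
    2 pi i which is continuous along each segment issued from 0, hence zero.
    So it is the integral above. *)

(** * Integration against a dilated Lebesgue measure *)

Section dilation.
Import HBNNSimple.
Context {R : realType}.
Local Open Scope classical_set_scope.
Local Open Scope ereal_scope.
Local Notation mu := (@lebesgue_measure R).

(** The two type annotations give the line the sigma-algebra on which
    [lebesgue_measure] lives, which makes image measures under a dilation
    available. *)
Let dil (r : R) : measurableTypeR R -> measurableTypeR R := fun x => (r * x)%R.

Let measurable_dil r : measurable_fun setT (dil r).
Proof. exact: measurable_funM. Qed.

(** Rescaling the image measure by r gives a measure which agrees with the
    Lebesgue measure on intervals. *)
Lemma lebesgue_measure_dilation (r : {posnum R}) (A : set R) : measurable A ->
  mu (( *%R r%:num) @^-1` A) = (r%:num^-1)%:E * mu A.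
Proof.
move=> mA; have r0 : (0 < r%:num)%R by [].
pose m : {measure set (measurableTypeR R) -> \bar R} :=
  mscale (NngNum (ltW r0))
    (measure_function_pushforward__canonical__measure_function_Measure mu
      (measurable_dil r%:num)).
suff E : mu A = m A.
  by rewrite [X in _ * X]E /m/= /mscale/= muleA -EFinM mulVf ?mul1e.
apply: (@lebesgue_measure_unique R m) => //= _ [[a b]] _ <-.
rewrite /m/= /mscale/= /pushforward/=.
have -> : dil r%:num @^-1` [set` `]a, b]%R] = [set` `]a / r%:num, b / r%:num]%R].
  apply/seteqP; split=> x /=; rewrite /dil !in_itv/= ltr_pdivrMr// ler_pdivlMr//;
    by rewrite (mulrC x).
rewrite !lebesgue_measure_itv/= !lte_fin ltr_pM2r ?invr_gt0//.
case: ifP => _; last by rewrite mule0.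
by rewrite -EFinB -EFinM -mulrBl mulrCA divff ?mulr1.
Qed.

Lemma measurable_ge0_integral_dilation (r : {posnum R}) (f : R -> \bar R) :
  measurable_fun [set: R] f -> (forall x, 0 <= f x) ->
  \int[mu]_x f (r%:num * x)%R = (r%:num^-1)%:E * \int[mu]_x f x.
Proof.
move=> mf f0; have r0 : (0 < r%:num^-1)%R by [].
transitivity (\int[pushforward mu (dil r%:num)]_x f x).
  exact/esym/(ge0_integral_pushforward (measurable_dil r%:num)).
rewrite -(@ge0_integral_mscale _ _ _ mu setT measurableT (NngNum (ltW r0)) f)//.
by apply: eq_measure_integral => //= A mA _; exact: lebesgue_measure_dilation.
Qed.

(** The integral of a nonnegative function is a supremum over the simple
    functions below it, so monotonicity does not depend on measurability. *)
Lemma ge0_integralT_mono d (T : measurableType d) (m : {measure set T -> \bar R})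
    (f g : T -> \bar R) :
  (forall x, 0 <= f x) -> (forall x, f x <= g x) ->
  \int[m]_x f x <= \int[m]_x g x.
Proof.
move=> f0 fg; rewrite !ge0_integralTE//; last first.
  by move=> x; exact: le_trans (fg x).
apply: le_ereal_sup => _ [h /= hf <-]; exists h => // x.
exact: le_trans (fg x).
Qed.

(** A simple function below f dilates to a measurable function below the
    dilated f, and for the former the change of variable is known. *)
Lemma ge0_integral_dilation_ge (a r : {posnum R}) (f : R -> \bar R) :
  (forall x, 0 <= f x) ->
  (a%:num / r%:num)%:E * \int[mu]_x f x <= \int[mu]_x (a%:num%:E * f (r%:num * x)%R).
Proof.
move=> f0; rewrite [in leLHS]ge0_integralTE//= muleC -lee_pdivlMr ?divr_gt0//.
apply: ge_ereal_sup => _ [h /= hf <-].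
rewrite lee_pdivlMr ?divr_gt0// muleC -integralT_nnsfun.
have mh : measurable_fun setT (EFin \o h) by exact/measurable_EFinP.
have h0 x : 0 <= (EFin \o h) x by rewrite lee_fin.
apply: (@le_trans _ _ (\int[mu]_x (a%:num%:E * (EFin \o h \o dil r%:num) x)));
  last first.
  apply: ge0_integralT_mono => x; first by rewrite mule_ge0// lee_fin.
  by rewrite lee_pmul2l//; exact: hf.
rewrite [leRHS]ge0_integralZl_EFin//; last 2 first.
- by move=> x _; exact: h0.
- exact: (measurableT_comp mh).
by rewrite EFinM -muleA lee_pmul2l// (measurable_ge0_integral_dilation r _ mh h0).
Qed.

(** The reverse inequality is the previous one for the inverse dilation. *)
Lemma ge0_integral_dilation (a r : {posnum R}) (f : R -> \bar R) :
  (forall x, 0 <= f x) ->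
  \int[mu]_x (a%:num%:E * f (r%:num * x)%R) = (a%:num / r%:num)%:E * \int[mu]_x f x.
Proof.
move=> f0; apply/eqP; rewrite eq_le ge0_integral_dilation_ge// andbT.
rewrite -lee_pdivrMl ?divr_gt0//.
have a0 : (0 < a%:num^-1)%R by []. have r0 : (0 < r%:num^-1)%R by [].
have := @ge0_integral_dilation_ge (PosNum a0) (PosNum r0)
  (fun x : R => a%:num%:E * f (r%:num * x)%R).
rewrite /= invrK invf_div mulrC => /(_ _)/le_trans; apply.
  by move=> x; rewrite mule_ge0.
apply: ge0_integralT_mono => [x|x]; first by rewrite !mule_ge0// lee_fin invr_ge0.
by rewrite mulrA divff// mul1r muleA -EFinM mulVf// mul1e.
Qed.

(** The identity survives the conventional value -oo of +oo - oo because c > 0;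
    it is stated for all x and y in order to apply to the integrals of the
    positive and negative parts of a non-integrable function. *)
Lemma muleBr_gt0 (c : R) (x y : \bar R) : (0 < c)%R ->
  c%:E * (x - y) = c%:E * x - c%:E * y.
Proof.
move=> c0; case: x => [x| |]; case: y => [y| |] //=;
  rewrite ?(gt0_muley, gt0_muleNy) ?lte_fin//= ?gt0_muleNy ?gt0_muley ?lte_fin//.
by rewrite -!EFinM -!EFinB mulrBr.
Qed.

Lemma integral_dilation (a r : {posnum R}) (f : R -> \bar R) :
  \int[mu]_x (a%:num%:E * f (r%:num * x)%R) = (a%:num / r%:num)%:E * \int[mu]_x f x.
Proof.
rewrite integralE [in RHS]integralE muleBr_gt0 ?divr_gt0//.
rewrite -!ge0_integral_dilation//.
congr (_ - _); apply: eq_integral => x _.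
- by rewrite (@ge0_funeposM _ _ _ (fun x : R => f (r%:num * x)%R))// !funeposE.
- by rewrite (@ge0_funenegM _ _ _ (fun x : R => f (r%:num * x)%R))// !funenegE.
Qed.

Lemma Rintegral_dilation (a r : {posnum R}) (f : R -> R) :
  (\int[mu]_x (a%:num * f (r%:num * x)) = a%:num / r%:num * \int[mu]_x f x)%R.
Proof.
rewrite /Rintegral (integral_dilation a r (EFin \o f)).
by case: (integral _ _ _) => [x| |]//=;
  rewrite ?gt0_muley ?gt0_muleNy ?lte_fin ?divr_gt0 ?mulr0.
Qed.

End dilation.

(** * Uniqueness of the characteristic exponent *)

Section uniqueness.
Import numFieldNormedType.Exports.
Context {R : realType}.
Local Open Scope complex_scope.

Lemma continuous_complex_Im : continuous (@complex.Im R : R[i]^o -> R^o).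
Proof.
move=> z; apply/(@cvgrPdist_lt _ R^o _ (nbhs z)) => e e0.
apply: filterS (@nbhsx_ballx _ R[i]^o z e%:C _) => [w|]; last by rewrite ltcR.
rewrite /ball/= normc_def ltcR; apply: le_lt_trans.
by rewrite -sqrtr_sqr ler_wsqrtr// -raddfB lerDr sqr_ge0.
Qed.

(** Otherwise, up to sign, h takes by the intermediate value theorem a value in
    ]0, pi], where cos < 1. *)
Lemma cos_eq1_path (h : R -> R) : continuous h -> h 0 = 0 ->
  (forall s, cos (h s) = 1) -> h 1 = 0.
Proof.
move=> ch h0 hcos.
wlog h1 : h ch h0 hcos / 0 <= h 1.
  move=> W; case: (leP 0 (h 1)) => [|h1]; first exact: W.
  apply/eqP; rewrite -oppr_eq0; apply/eqP; apply: (W (fun x => - h x)).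
  - by move=> x; apply: continuousN; exact: ch.
  - by rewrite h0 oppr0.
  - by move=> s; rewrite cosN.
  - by rewrite oppr_ge0 ltW.
apply/eqP; rewrite eq_le h1 andbT leNgt; apply/negP => h1p.
pose v := Num.min (h 1) pi.
have v0 : 0 < v by rewrite lt_min h1p pi_gt0.
have [||c _ hc] := @IVT R h 0 1 v ler01.
- by apply: continuous_subspaceT => x; exact: ch.
- by rewrite h0 min_l// max_r// ltW//= ge_min lexx.
have := hcos c; rewrite hc => cv.
have : cos v < cos 0.
  by rewrite ltr_cos// !in_itv/= ?lexx ?pi_ge0// ltW//= ge_min lexx orbT.
by rewrite cos0 cv ltxx.
Qed.

Lemma cexp_inj_mod (z w : R[i]) : cexp z = cexp w ->
  complex.Re z = complex.Re w /\ cos (complex.Im z - complex.Im w) = 1.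
Proof.
case: z w => [a b] [c d]; rewrite /cexp/= => -[E1 E2].
(* The moduli agree: this is the sum of the squares of E1 and E2. *)
have E0 : expR a = expR c.
  apply/eqP; rewrite -(@eqrXn2 _ 2)// ?expR_ge0//; apply/eqP.
  by rewrite -[LHS]mulr1 -[RHS]mulr1 -{1}(cos2Dsin2 b) -(cos2Dsin2 d)
     !mulrDr -!exprMn E1 E2.
split; first exact: expR_inj.
have e0 : expR c != 0 by rewrite gt_eqF ?expR_gt0.
move: E1 E2; rewrite E0 => /(mulfI e0) E1 /(mulfI e0) E2.
by rewrite cosB E1 E2 -!expr2 cos2Dsin2.
Qed.

Context {d} {Omega : measurableType d} {P : probability Omega R}.

(** The real parts agree since exp is injective on the reals; the imaginary
    parts differ by a multiple of 2 pi, and [cos_eq1_path] applies to their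
    difference along the segment from 0 to theta. *)
Lemma char_exponent_unique (X : {nonneg R} -> {RV P >-> R}) k
    (t : 'I_k -> {nonneg R}) psi1 psi2 :
  is_char_exponent X t psi1 -> is_char_exponent X t psi2 -> psi1 = psi2.
Proof.
move=> [c1 z1 e1] [c2 z2 e2]; apply/funext => theta.
have E s : complex.Re (psi1 (s *: theta)) = complex.Re (psi2 (s *: theta)) /\
  cos (complex.Im (psi1 (s *: theta)) - complex.Im (psi2 (s *: theta))) = 1.
  have /cexp_inj_mod : cexp (- psi1 (s *: theta)) = cexp (- psi2 (s *: theta)).
    by rewrite -e1 -e2.
  rewrite !raddfN/= => -[/oppr_inj -> <-]; split=> //.
  by rewrite -cosN opprD opprK.
apply/eqP; rewrite eq_complex; have := (E 1).1; rewrite scale1r => ->.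
rewrite eqxx/= -subr_eq0; apply/eqP.
pose h s := complex.Im (psi1 (s *: theta)) - complex.Im (psi2 (s *: theta)).
have : h 1 = 0; last by rewrite /h scale1r.
apply: cos_eq1_path; last by move=> s; exact: (E s).2.
- have cline (psi : 'rV[R]_k -> R[i]^o) : continuous psi ->
     continuous (fun s : R => complex.Im (psi (s *: theta))).
    move=> cpsi s.
    have cline : {for s, continuous (fun s : R => psi (s *: theta))}.
      exact: (continuous_comp (@scalel_continuous R _ theta s) (cpsi _)).
    apply: (@continuous_comp _ _ _ _ (@complex.Im R : R[i]^o -> R^o) s cline).
    exact: continuous_complex_Im.
  by move=> s; exact: (cvgB (cline _ c1 s) (cline _ c2 s)).
- by rewrite /h !scale0r z1 z2 subrr.
Qed.

Lemma char_exponentE (X : {nonneg R} -> {RV P >-> R}) k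
    (t : 'I_k -> {nonneg R}) psi :
  is_char_exponent X t psi -> char_exponent X t = psi.
Proof.
move=> hpsi; apply: xget_unique => // psi' hpsi'.
exact: (char_exponent_unique X k t psi' psi hpsi' hpsi).
Qed.

End uniqueness.

(** * Homogeneity of the exponent of Z_beta *)

Section homogeneity.
Context {R : realType}.

Lemma Zbeta_kernel_dilation (r : {posnum R}) (x u : R) :
  Zbeta_kernel x (r%:num * u) = r%:num * Zbeta_kernel (r%:num * x) u.
Proof.
rewrite /Zbeta_kernel !pmulr_rgt0//; case: ifP => [/andP[x0 _]|_]; last by rewrite mulr0.
have := lt0r_neq0 x0 => x1; rewrite (mulrC r%:num x) !mulrA; field.
by rewrite x1 andbT gt_eqF.
Qed.

Definition Zbeta_energy {k} (t : 'I_k -> {nonneg R}) (theta : 'rV[R]_k) (x : R) : R :=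
  \int[lebesgue_measure]_s
        (\sum_(j < k) theta 0 j *
           (Zbeta_kernel x ((t j)%:num - s) - Zbeta_kernel x (- s))) ^+ 2.

(** Three powers of the dilation factor appear: two because the kernel is
    squared, one from ds. *)
Lemma Zbeta_energy_dilation (r : {posnum R}) k (t : 'I_k -> {nonneg R})
    (theta : 'rV[R]_k) (x : R) :
  Zbeta_energy (fun j => (r%:num * (t j)%:num)%:nng) theta x =
  Zbeta_energy t (r%:num `^ (3 / 2) *: theta) (r%:num * x).
Proof.
rewrite /Zbeta_energy.
set F := fun s => (\sum_(j < k) (r%:num `^ (3 / 2) *: theta) 0 j *
   (Zbeta_kernel (r%:num * x) ((t j)%:num - s) - Zbeta_kernel (r%:num * x) (- s))) ^+ 2.
have := Rintegral_dilation (r%:num^-1)%:pos (r%:num^-1)%:pos F.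
rewrite /= divff// mul1r => <-; apply: eq_Rintegral => s _.
rewrite /F -[s in LHS](@mulVKf _ r%:num)//.
have r3 : (r%:num `^ (3 / 2)) ^+ 2 = r%:num ^+ 3.
  by rewrite -powR_mulrn ?powR_ge0// -powRrM divfK// powR_mulrn.
(* The kernels produce r ^+ 2, written r^-1 * r ^+ 3 since r^-1 is the factor
   coming from ds and r ^+ 3 is the square of r `^ (3 / 2). *)
transitivity (r%:num^-1 * r%:num ^+ 3 * (\sum_(j < k) theta 0 j *
   (Zbeta_kernel (r%:num * x) ((t j)%:num - r%:num^-1 * s) -
    Zbeta_kernel (r%:num * x) (- (r%:num^-1 * s)))) ^+ 2).
  rewrite [_ * r%:num ^+ 3](_ : _ = r%:num ^+ 2); last by rewrite exprS mulKf.
  rewrite -exprMn mulr_sumr; congr (_ ^+ 2); apply: eq_bigr => j _ /=.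
  by rewrite -mulrN -mulrDr !Zbeta_kernel_dilation -mulrBr mulrCA.
rewrite -r3 -mulrA -exprMn mulr_sumr; congr (_ * _ ^+ 2); apply: eq_bigr => j _.
by rewrite mxE mulrA.
Qed.

(** The weight contributes x ^ beta = r ^ (- beta) (r x) ^ beta, and dx one more
    factor r^-1. *)
Lemma Zbeta_exponent_dilation (beta C : R) (r : {posnum R}) k
    (t : 'I_k -> {nonneg R}) (theta : 'rV[R]_k) :
  Zbeta_exponent beta C (fun j => (r%:num * (t j)%:num)%:nng) theta =
  r%:num `^ (- beta - 1) * Zbeta_exponent beta C t (r%:num `^ (3 / 2) *: theta).
Proof.
pose G k (t : 'I_k -> {nonneg R}) theta : R -> R :=
  patch (fun=> 0) `]0, +oo[%classic
    (fun y => (expR (- (1 / 2) * Zbeta_energy t theta y) - 1) * y `^ beta).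
have expE j (t' : 'I_j -> {nonneg R}) th :
    Zbeta_exponent beta C t' th = - C * \int[lebesgue_measure]_x G j t' th x.
  by rewrite /Zbeta_exponent Rintegral_mkcond.
rewrite !expE [RHS]mulrCA; congr (_ * _).
have a0 : 0 < r%:num `^ (- beta) by exact: powR_gt0.
pose a := PosNum a0.
have -> : r%:num `^ (- beta - 1) = a%:num / r%:num.
  rewrite powRD; last by apply/implyP => _; rewrite gt_eqF.
  by rewrite [r%:num `^ (-1)]powRN powRr1.
rewrite -Rintegral_dilation; apply: eq_Rintegral => x _.
have mem0 (y : R) : (y \in `]0, +oo[%classic) = (0 < y).
  by apply/idP/idP; rewrite inE/= in_itv/= andbT.
rewrite /G /patch !mem0 pmulr_rgt0//.
case: ifPn => [x0|_]; last by rewrite mulr0.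
rewrite Zbeta_energy_dilation mulrCA; congr (_ * _).
rewrite powRM ?ltW// mulrA -powRD; first by rewrite addNr powRr0 mul1r.
by apply/implyP => _; rewrite gt_eqF.
Qed.

End homogeneity.

Theorem proposition3p1 (R : realType) (d : measure_display)
    (Omega : measurableType d) (P : probability Omega R) (beta C : R)
    (Z : {nonneg R} -> {RV P >-> R}) :
  - 1 < beta -> beta < 1 -> 0 < C -> is_Zbeta beta C Z ->
  dilatively_stable (1 - beta / 2) (- beta - 1) Z.
Proof.
move=> _ _ _ [idZ expZ]; split=> // T k theta t k0.
rewrite (char_exponentE _ _ _ _ (expZ k _ k0)).
rewrite (char_exponentE _ _ _ _ (expZ k t k0)).
have -> : 1 - beta / 2 - (- beta - 1) / 2 = 3 / 2 by field.
by rewrite Zbeta_exponent_dilation rmorphM.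
Qed.
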